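(* Let $k$ be a field, let $(S,\mathfrak m)=k[[x_0,x_1,x_2]]$, and let $I\subseteq S$ be an $\mathfrak m$-primary ideal. Then $$e(I)\le6\,\ell(S/I)-3\,\ell(S/(I+(x_1)))-3\,\ell(S/(I+(x_2)))+\ell(S/(I+(x_1,x_2))),$$ and equality holds when $I=\mathfrak m^n$.
   Context: $\ell$ denotes length, and for an $\mathfrak m$-primary ideal $I$ of a local ring $(S,\mathfrak m)$ of dimension $d$, $e(I)=\lim_{n\to\infty}d!\,\ell(S/I^n)/n^d$ is the Hilbert--Samuel multiplicity. *)

(* Defs.v *)
From HB Require Import structures.
From mathcomp Require Import all_boot all_order all_algebra ring_quotient.
From mathcomp Require Import mpoly.
From mathcomp Require Import boolp classical_sets.
From mathcomp Require Import reals ereal topology normedtype sequences.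

Set Implicit Arguments.
Unset Strict Implicit.
Unset Printing Implicit Defensive.

Import Order.TTheory GRing.Theory Num.Theory.
Local Open Scope ring_scope.

(* Formal power series in n variables, as coefficient functions on the
   exponents [m : 'X_{1..n}].  The wrapper keeps the Cauchy product apart from
   the pointwise ring structure that MathComp-Analysis puts on functions. *)
Record mpseries (n : nat) (R : Type) :=
  MPSeries { mpscoef : 'X_{1..n} -> R }.

HB.instance Definition _ n R := gen_eqMixin (mpseries n R).
HB.instance Definition _ n R := gen_choiceMixin (mpseries n R).

Lemma mpseriesP n R (f g : mpseries n R) :
  (forall m, mpscoef f m = mpscoef g m) -> f = g.
Proof.
by case: f g => [f] [g] /= fg; congr MPSeries; apply/funext.
Qed.

Section MPSeriesZmod.
Variables (n : nat) (R : zmodType).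
Implicit Types f g h : mpseries n R.

Definition mps_zero : mpseries n R := MPSeries (fun _ => 0).
Definition mps_opp f : mpseries n R := MPSeries (fun m => - mpscoef f m).
Definition mps_add f g : mpseries n R :=
  MPSeries (fun m => mpscoef f m + mpscoef g m).

Lemma mps_addA : associative mps_add.
Proof. by move=> f g h; apply: mpseriesP => m /=; rewrite addrA. Qed.
Lemma mps_addC : commutative mps_add.
Proof. by move=> f g; apply: mpseriesP => m /=; rewrite addrC. Qed.
Lemma mps_add0 : left_id mps_zero mps_add.
Proof. by move=> f; apply: mpseriesP => m /=; rewrite add0r. Qed.
Lemma mps_addN : left_inverse mps_zero mps_opp mps_add.
Proof. by move=> f; apply: mpseriesP => m /=; rewrite addNr. Qed.

HB.instance Definition _ := GRing.isZmodule.Build (mpseries n R)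
  mps_addA mps_addC mps_add0 mps_addN.

End MPSeriesZmod.

Section MPSeriesRing.
Variables (n : nat) (R : comNzRingType).
Implicit Types f g h : mpseries n R.

Definition mps_one : mpseries n R := MPSeries (fun m => (m == 0%MM)%:R).

(* The degree bounds only make the index type finite: every pair of exponents
   with sum m satisfies them. *)
Definition mps_mul f g : mpseries n R := MPSeries (fun m =>
  \sum_(a : 'X_{1..n < (mdeg m).+1, (mdeg m).+1} | m == (a.1 + a.2)%MM)
     mpscoef f a.1 * mpscoef g a.2).

Definition mps_trunc (d : nat) f : {mpoly R[n]} :=
  \sum_(m : 'X_{1..n < d}) mpscoef f m *: 'X_[m].

Lemma mcoeff_trunc d f m : (mdeg m < d)%N -> (mps_trunc d f)@_m = mpscoef f m.
Proof.
move=> md; rewrite /mps_trunc raddf_sum /= (bigD1 (BMultinom md)) //=.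
rewrite mcoeffZ mcoeffX eqxx mulr1 big1 ?addr0 // => a ne.
rewrite mcoeffZ mcoeffX; case: eqP => [am|]; last by rewrite mulr0.
by case/eqP: ne; apply: val_inj.
Qed.

Lemma mps_mulE d f g m : (mdeg m < d)%N ->
  mpscoef (mps_mul f g) m = (mps_trunc d f * mps_trunc d g)@_m.
Proof.
move=> md; rewrite mcoeffM; apply: eq_bigr => -[a b] /= _.
by rewrite !mcoeff_trunc //;
  [move: (bmdeg b) | move: (bmdeg a)] => /leq_trans; apply.
Qed.

Lemma mcoeffM_trunc d (p q p' q' : {mpoly R[n]}) m : (mdeg m < d)%N ->
  (forall a, (mdeg a < d)%N -> p@_a = p'@_a) ->
  (forall a, (mdeg a < d)%N -> q@_a = q'@_a) ->
  (p * q)@_m = (p' * q')@_m.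
Proof.
move=> md pp qq; rewrite !mcoeffM; apply: eq_bigr => -[a b] /= _.
by rewrite pp ?qq //;
  [move: (bmdeg b) | move: (bmdeg a)] => /leq_trans; apply.
Qed.

Lemma mps_mulC : commutative mps_mul.
Proof.
by move=> f g; apply: mpseriesP => m; rewrite !(mps_mulE _ _ (ltnSn _)) mulrC.
Qed.

Lemma mps_mulA : associative mps_mul.
Proof.
move=> f g h; apply: mpseriesP => m; set d := (mdeg m).+1.
have md : (mdeg m < d)%N by exact: ltnSn.
rewrite !(mps_mulE _ _ md).
rewrite (mcoeffM_trunc (p' := mps_trunc d f)
  (q' := mps_trunc d g * mps_trunc d h) md) //; last first.
  by move=> a ad; rewrite mcoeff_trunc // (mps_mulE _ _ ad).
rewrite mulrA; apply: mcoeffM_trunc md _ _ => // a ad.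
by rewrite mcoeff_trunc // (mps_mulE _ _ ad).
Qed.

Lemma mps_mul1 : left_id mps_one mps_mul.
Proof.
move=> f; apply: mpseriesP => m; set d := (mdeg m).+1.
have md : (mdeg m < d)%N by exact: ltnSn.
rewrite (mps_mulE _ _ md) (mcoeffM_trunc (p' := 1) (q' := mps_trunc d f) md) //.
  by rewrite mul1r mcoeff_trunc.
by move=> a ad; rewrite mcoeff_trunc // mcoeff1.
Qed.

Lemma mps_mulDl : left_distributive mps_mul +%R.
Proof.
move=> f g h; apply: mpseriesP => m; rewrite /= -big_split /=.
by apply: eq_bigr => a _; rewrite mulrDl.
Qed.

Lemma mps_one_neq0 : mps_one != 0.
Proof.
apply/eqP => /(congr1 (fun f => mpscoef f 0%MM)) /= /eqP.
by rewrite eqxx oner_eq0.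
Qed.

HB.instance Definition _ := GRing.Zmodule_isComNzRing.Build (mpseries n R)
  mps_mulA mps_mulC mps_mul1 mps_mulDl mps_one_neq0.

Definition mpsX (i : 'I_n) : mpseries n R :=
  MPSeries (fun m => (m == U_(i)%MM)%:R).

End MPSeriesRing.

(* [GRing.submodClosed] would not do as the type of submodules: it has no
   inferable [zmodClosed] structure, which [Quotient.quot] needs. *)
Record submodule (A : pzRingType) (V : lmodType A) := Submodule {
  submodule_pred :> {pred V};
  submoduleP : GRing.submod_closed submodule_pred
}.

HB.instance Definition _ (A : pzRingType) (V : lmodType A) (W : submodule V) :=
  GRing.isSubmodClosed.Build A V (submodule_pred W) (submoduleP W).

Section QuotientModule.
Variables (A : pzRingType) (V : lmodType A) (W : submodule V).
Local Notation Q := (@Quotient.quot V (submodule_pred W)).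
Local Open Scope quotient_scope.

Let piD : {morph \pi_Q : u v / u + v}.
Proof. exact: Quotient.pi_add. Qed.

Definition quot_scale (a : A) (x : Q) : Q := \pi_Q (a *: repr x).

Lemma pi_quot_scale a v : quot_scale a (\pi_Q v) = \pi_Q (a *: v).
Proof.
apply/eqP; rewrite /quot_scale -Quotient.idealrBE -scalerBr rpredZ //.
by rewrite Quotient.idealrBE reprK.
Qed.

Lemma quot_scaleA a b x : quot_scale a (quot_scale b x) = quot_scale (a * b) x.
Proof. by rewrite -[x]reprK !pi_quot_scale scalerA reprK. Qed.

Lemma quot_scale1 : left_id 1 quot_scale.
Proof. by move=> x; rewrite -[x]reprK pi_quot_scale scale1r. Qed.

Lemma quot_scaleDr : right_distributive quot_scale +%R.
Proof.
move=> a x y; rewrite -[x]reprK -[y]reprK -piD !pi_quot_scale -piD.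
by rewrite scalerDr.
Qed.

Lemma quot_scaleDl x : {morph quot_scale^~ x : a b / a + b}.
Proof.
by move=> a b; rewrite -[x]reprK !pi_quot_scale -piD scalerDl.
Qed.

HB.instance Definition _ := GRing.Zmodule_isLmodule.Build A Q
  quot_scaleA quot_scale1 quot_scaleDr quot_scaleDl.

End QuotientModule.

Section ModuleLength.
Variables (R : realType) (A : pzRingType) (V : lmodType A).

Definition strict_chain (n : nat) (N : nat -> submodule V) : Prop :=
  forall i, (i < n)%N ->
    {subset N i <= N i.+1} /\ ~ {subset N i.+1 <= N i}.

Definition mlength : \bar R :=
  ereal_sup [set (n%:R)%:E | n in [set n | exists N, strict_chain n N]].

End ModuleLength.
Arguments mlength R {A} V.

Notation ideal A := (submodule A^o).

Section Ideals.
Variable A : comNzRingType.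
Implicit Types (I J : ideal A) (P : set A).

Definition idgen_pred P : {pred A^o} := fun x =>
  `[< forall J, (forall y, P y -> y \in J) -> x \in J >].

Lemma idgen_closed P : GRing.submod_closed (idgen_pred P).
Proof.
split=> [|a x y /asboolP Px /asboolP Py]; apply/asboolP => J PJ.
  by rewrite rpred0.
by rewrite rpredD ?rpredZ ?Px ?Py.
Qed.

Definition idgen P : ideal A := Submodule (idgen_closed P).

Definition idealD I J : ideal A :=
  idgen [set x | exists2 y, y \in I & exists2 z, z \in J & x = y + z].

Definition idealM I J : ideal A :=
  idgen [set x | exists2 y, y \in I & exists2 z, z \in J & x = y * z].

Fixpoint idealX I (n : nat) : ideal A :=
  if n is n'.+1 then idealM I (idealX I n') else idgen [set 1].

Definition primary I : Prop :=
  1 \notin I /\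
  forall x y : A, x * y \in I -> x \in I \/ exists n, y ^+ n \in I.

(* [primary_to J I]: the ideal I is J-primary. *)
Definition primary_to J I : Prop :=
  primary I /\ forall x : A, (exists n, x ^+ n \in I) <-> x \in J.

(* The Hilbert-Samuel multiplicity of I when A is local of Krull dimension [d]
   (d = n for power series in n variables over a field).  [limn] is only
   meaningful for a convergent sequence, as is the case when I is primary to
   the maximal ideal of a Noetherian A. *)
Definition multiplicity (R : realType) (d : nat) I : \bar R :=
  limn (fun n : nat =>
    ((d`!)%:R / n%:R ^+ d)%:E * mlength R {ideal_quot (idealX I n)})%E.

End Ideals.

Definition mps_max (n : nat) (R : comNzRingType) : ideal (mpseries n R) :=
  idgen [set mpsX R i | i in [set: 'I_n]].

(* Main.v *)
Require Import Defs.
From mathcomp Require Import all_boot all_order all_algebra ring_quotient.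
From mathcomp Require Import mpoly.
From mathcomp Require Import boolp classical_sets.
From mathcomp Require Import reals ereal topology normedtype sequences.
From mathcomp Require Import zify ring lra.

(* Order exponents lexicographically with x_2 most significant, then x_1, and let
   the smallest exponent of a series lead.  The length of S/J is then the number
   of exponents which do not lead any element of J, and this number for I^n is at
   most that for the n-fold sumset of the leading exponents of I.
     Let h(y, z) be the least x such that x_0^x x_1^y x_2^z is a leading monomial
   of I.  Cut the quadrant of the pairs (y, z) into unimodular triangles by the
   lines y, z, y + z = const.  A point of the n-fold dilate of a triangle is a sum
   of n of its vertices, so the minimal x of the n-fold sumset lies below n times
   the piecewise linear interpolation of h.  Summing over the quadrant bounds e(I)
   by the sum over the vertices of h times the number of triangles at the vertex:
   6 inside, 3 on an axis and 1 at the origin, which is the claimed expression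
   because the axis terms are at least the lengths of the quotients by x_1 and x_2,
   and the term at the origin is at most the length modulo (x_1, x_2).
     The same estimate applied to I^p gives e_(pq) <= (q^3 + q^2) e_p for the
   lengths e_n of S/I^n, whence the convergence of e_n / n^3. *)

Set Implicit Arguments.
Unset Strict Implicit.
Unset Printing Implicit Defensive.
Import Order.TTheory GRing.Theory Num.Theory.
Import numFieldNormedType.Exports.

(** * The lexicographic order on exponents *)

Section LexOrder.
Local Open Scope nat_scope.
Implicit Types a b c u v : 'X_{1..3}.

Definition o0 : 'I_3 := inord 0.
Definition o1 : 'I_3 := inord 1.
Definition o2 : 'I_3 := inord 2.

Lemma ord3P (P : 'I_3 -> Prop) : P o0 -> P o1 -> P o2 -> forall i, P i.
Proof.
move=> P0 P1 P2 i; rewrite -(inord_val i).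
by case: i => -[|[|[|i]]] // lti.
Qed.

Lemma mnm3P a b : a o0 = b o0 -> a o1 = b o1 -> a o2 = b o2 -> a = b.
Proof. by move=> *; apply/mnmP; apply: ord3P. Qed.

Lemma mnm3_le a b : (a <= b)%MM = [&& a o0 <= b o0, a o1 <= b o1 & a o2 <= b o2].
Proof.
apply/mnm_lepP/and3P => [le_ab|[le0 le1 le2]]; first by split.
by apply: ord3P.
Qed.

Definition mnm3 (x y z : nat) : 'X_{1..3} := [multinom nth 0 [:: x; y; z] i | i < 3].

Lemma mnm3E x y z :
  (mnm3 x y z o0 = x) * (mnm3 x y z o1 = y) * (mnm3 x y z o2 = z).
Proof. by rewrite !mnmE /= !inordK. Qed.

Lemma mnm3K a : mnm3 (a o0) (a o1) (a o2) = a.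
Proof. by apply: mnm3P; rewrite mnm3E. Qed.

Lemma mdeg_mnm3 x y z : mdeg (mnm3 x y z) = x + y + z.
Proof.
by rewrite mdegE !big_ord_recl big_ord0 !mnmE /= addn0 addnA.
Qed.

(* The lowest power of x_2 leads, then that of x_1: reduction modulo x_2, or
   modulo x_1 and x_2, then commutes with taking leading exponents. *)
Definition lexlt a b : bool :=
  (a o2 < b o2) || (a o2 == b o2) &&
  ((a o1 < b o1) || (a o1 == b o1) && (a o0 < b o0)).

Lemma lexlt_total a b : a != b -> ~~ lexlt a b -> lexlt b a.
Proof.
move=> /eqP neq nlt; apply: contraT => nlt'; case: neq.
by apply: mnm3P; move: nlt nlt'; rewrite /lexlt; lia.
Qed.

Lemma lexlt_irr a : lexlt a a = false.
Proof. rewrite /lexlt; lia. Qed.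

Lemma lexlt_trans a b c : lexlt a b -> lexlt b c -> lexlt a c.
Proof. rewrite /lexlt; lia. Qed.

(** A divisor of a monomial never comes after it, so [agree] applies to the set of exponents below
    [c]. *)
Lemma lexlt_addr u v c : lexlt (u + v) c -> lexlt v c.
Proof. rewrite /lexlt !mnmDE; lia. Qed.

Lemma lexlt_add u v a b : lexlt (u + v) (a + b) -> lexlt u a \/ lexlt v b.
Proof. rewrite /lexlt !mnmDE; lia. Qed.

(** The order is compatible with addition: if neither summand drops, neither can grow. So the
    coefficient of a product at [a + b] only sees the two leading terms. *)
Lemma lexlt_add_eq u v a b :
  (u + v)%MM = (a + b)%MM -> [\/ lexlt u a, lexlt v b | (u = a /\ v = b)].
Proof.
move=> /mnmP eq_ab; have := (eq_ab o0, eq_ab o1, eq_ab o2).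
rewrite !mnmDE => -[[e0 e1] e2].
have [ltua|nltua] := boolP (lexlt u a); first exact: Or31.
have [ltvb|nltvb] := boolP (lexlt v b); first exact: Or32.
apply: Or33; move: nltua nltvb; rewrite /lexlt => nltua nltvb.
by split; apply: mnm3P; lia.
Qed.

Definition boxed B a := [&& a o0 < B, a o1 < B & a o2 < B].

(** Reading a boxed exponent in base [B] turns the order into that of the numbers below [B ^ 3], so
    that arguments climbing in it terminate. *)
Definition lexrank B a := (a o2 * B + a o1) * B + a o0.

Lemma lexrank_lt B a : boxed B a -> lexrank B a < B ^ 3.
Proof.
rewrite /lexrank => /and3P[a0 a1 a2]; rewrite !expnS expn0 muln1.
have : a o2 * B + a o1 <= B * B - 1 by nia.
by nia.
Qed.

Lemma lexlt_rank B a b : boxed B a -> boxed B b -> lexlt a b ->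
  lexrank B a < lexrank B b.
Proof.
rewrite /lexrank => /and3P[a0 a1 a2] /and3P[b0 b1 b2].
case/orP => [lt2|/andP[/eqP -> /orP[lt1|/andP[/eqP -> lt0]]]]; last 2 first.
- have : (b o2 * B + a o1).+1 <= b o2 * B + b o1 by lia.
  by nia.
- by lia.
have : (a o2 * B + a o1).+1 <= b o2 * B + b o1 by nia.
by nia.
Qed.

Lemma lexrank_eq B a b : boxed B a -> boxed B b ->
  lexrank B a = lexrank B b -> a = b.
Proof.
move=> ba bb eqr; apply/eqP; apply: contraT => /lexlt_total tot.
have [/(lexlt_rank ba bb)|/tot /(lexlt_rank bb ba)] := boolP (lexlt a b);
  by rewrite eqr ltnn.
Qed.

End LexOrder.

(** * Power series and ideals *)

Section Series.
Local Open Scope ring_scope.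
Variable k : comNzRingType.
Local Notation S := (mpseries 3 k).
Implicit Types (f g h : S) (a b c u v : 'X_{1..3}).

Lemma coefpsD f g a : mpscoef (f + g) a = mpscoef f a + mpscoef g a.
Proof. by []. Qed.

Lemma coefpsB f g a : mpscoef (f - g) a = mpscoef f a - mpscoef g a.
Proof. by []. Qed.

Lemma coefps0 a : mpscoef (0 : S) a = 0.
Proof. by []. Qed.

Lemma coefpsM f g a : mpscoef (f * g) a =
  \sum_(p : 'X_{1..3 < (mdeg a).+1, (mdeg a).+1} | a == (p.1 + p.2)%MM)
     mpscoef f p.1 * mpscoef g p.2.
Proof. by []. Qed.

Lemma coefpsM_eq0 f g a :
  (forall u v, a = (u + v)%MM -> mpscoef f u * mpscoef g v = 0) ->
  mpscoef (f * g) a = 0.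
Proof. by move=> fg0; rewrite coefpsM big1 // => p /eqP /fg0. Qed.

Lemma coefpsM_single f g a b :
  (forall u v, (u + v)%MM = (a + b)%MM -> (u, v) <> (a, b) ->
    mpscoef f u * mpscoef g v = 0) ->
  mpscoef (f * g) (a + b) = mpscoef f a * mpscoef g b.
Proof.
move=> fg0; rewrite coefpsM.
have da : (mdeg a < (mdeg (a + b)).+1)%N by rewrite mdegD ltnS leq_addr.
have db : (mdeg b < (mdeg (a + b)).+1)%N by rewrite mdegD ltnS leq_addl.
rewrite (bigD1 (BMultinom da, BMultinom db)) //= big1 ?addr0 //.
move=> [u v] /= /andP[/eqP uv /eqP ne]; apply: fg0 => // -[ua vb].
by case: ne; congr pair; apply: val_inj.
Qed.

Definition mpsmon a : S := MPSeries (fun b => (b == a)%:R).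

Definition mpsdiv a f : S := MPSeries (fun b => mpscoef f (a + b)%MM).

Lemma mpsmon_div a f : (forall b, ~~ (a <= b)%MM -> mpscoef f b = 0) ->
  f = mpsmon a * mpsdiv a f.
Proof.
move=> f0; apply: mpseriesP => b; have [le_ab|nle] := boolP (a <= b)%MM.
  rewrite -[b](submK le_ab) addmC coefpsM_single /= ?eqxx ?mul1r //.
  move=> u v /eqP uv ne; case: eqP => [ua|]; last by rewrite mul0r.
  by move: uv ne; rewrite ua eqm_add2l => /eqP ->.
rewrite f0 // coefpsM_eq0 // => u v buv /=; case: eqP => [ua|]; last by rewrite mul0r.
by move: nle; rewrite buv ua lem_addr.
Qed.

Lemma mpsmonD a b : mpsmon (a + b) = mpsmon a * mpsmon b.
Proof.
rewrite {1}[mpsmon (a + b)](@mpsmon_div a) => [|c] /=.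
  by congr (_ * _); apply: mpseriesP => c /=; rewrite eqm_add2l.
by case: eqP => // ->; rewrite lem_addr.
Qed.

Lemma mpsmon0 : mpsmon 0%MM = 1.
Proof. by []. Qed.

Lemma mpsmonMn a n : mpsmon (a *+ n) = mpsmon a ^+ n.
Proof.
by elim: n => [|n IHn]; rewrite ?mulm0n ?mpsmon0 // mulmS mpsmonD IHn exprS.
Qed.

Lemma mpsmonX i n : mpsX k i ^+ n = mpsmon (U_(i) *+ n).
Proof. by rewrite mpsmonMn. Qed.

Section Agree.
Variables (T : 'X_{1..3} -> Prop) (J : ideal S).
Hypothesis downT : forall u v, T (u + v)%MM -> T v.

(* [agree T J] is J plus the ideal of the series which vanish on T. *)
Definition agree_pred : {pred S^o} := fun h =>
  `[< exists2 f, f \in J & forall a, T a -> mpscoef h a = mpscoef f a >].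

(** Closure under multiplication is where [downT] enters: the coefficient of [x * f] at a point of
    [T] involves [f] only at divisors of that point, which lie in [T] again. *)
Lemma agree_closed : GRing.submod_closed agree_pred.
Proof.
split=> [|x f g /asboolP[f' Jf' ff'] /asboolP[g' Jg' gg']]; apply/asboolP.
  by exists 0; rewrite ?rpred0.
exists (x *: f' + g'); first by rewrite rpredD ?rpredZ.
move=> a Ta; rewrite !coefpsD gg' //; congr (_ + _).
apply: eq_bigr => p /eqP ap; rewrite ff' //; apply: downT (val p.1) _ _.
by rewrite -ap.
Qed.

Definition agree : ideal S := Submodule agree_closed.

Lemma agreeP h : reflect
  (exists2 f, f \in J & forall a, T a -> mpscoef h a = mpscoef f a) (h \in agree).
Proof. exact: asboolP. Qed.

Lemma agree_sub : {subset J <= agree}.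
Proof. by move=> f Jf; apply/agreeP; exists f. Qed.

End Agree.

Lemma ideal_add (J : ideal S) f g : f \in J -> g \in J -> f + g \in J.
Proof. exact: (@rpredD S^o J). Qed.

Lemma ideal_opp (J : ideal S) f : f \in J -> - f \in J.
Proof. by rewrite (@rpredN S^o J). Qed.

Lemma ideal_mull (J : ideal S) f g : g \in J -> f * g \in J.
Proof. by move=> Jg; apply: (@rpredZ S S^o J f g). Qed.

Lemma idgen_mem (P : set S) x : P x -> x \in idgen P.
Proof. by move=> Px; apply/asboolP => J; apply. Qed.

Lemma idgen_sub (P : set S) (J : ideal S) :
  (forall x, P x -> x \in J) -> {subset idgen P <= J}.
Proof. by move=> PJ x /asboolP; apply. Qed.

Lemma idealD_subl (I J : ideal S) : {subset I <= idealD I J}.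
Proof.
move=> x Ix; apply: idgen_mem; exists x => //; exists 0; rewrite ?rpred0 //.
by rewrite addr0.
Qed.

Lemma idealD_subr (I J : ideal S) : {subset J <= idealD I J}.
Proof.
move=> x Jx; apply: idgen_mem; exists 0; rewrite ?rpred0 //.
by exists x; rewrite ?add0r.
Qed.

Lemma idealD_min (I J K : ideal S) :
  {subset I <= K} -> {subset J <= K} -> {subset idealD I J <= K}.
Proof.
move=> IK JK; apply: idgen_sub => x [y Iy [z Jz ->]].
by apply: ideal_add; [apply: IK|apply: JK].
Qed.

Lemma idealM_mem (I J : ideal S) f g : f \in I -> g \in J -> f * g \in idealM I J.
Proof. by move=> If Jg; apply: idgen_mem; exists f => //; exists g. Qed.

Lemma idealM_subr (I J : ideal S) : {subset idealM I J <= J}.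
Proof. by apply: idgen_sub => x [y Iy [z Jz ->]]; apply: ideal_mull. Qed.

Lemma idealX_mem (I : ideal S) f n : f \in I -> f ^+ n \in idealX I n.
Proof.
move=> If; elim: n => [|n IHn] /=; first exact: idgen_mem.
by rewrite exprS; apply: idealM_mem.
Qed.

End Series.

Arguments mpsmon {k}.

(** * Leading exponents and length *)

Section LeadingExponents.
Local Open Scope ring_scope.
Variable k : fieldType.
Local Notation S := (mpseries 3 k).
Implicit Types (f g h : S) (I J K : ideal S) (a b c u v : 'X_{1..3}).

Definition lead f a : Prop :=
  mpscoef f a != 0 /\ forall b, lexlt b a -> mpscoef f b = 0.

Definition lexp J a : bool := `[< exists2 f, f \in J & lead f a >].

Lemma lexpP J a : reflect (exists2 f, f \in J & lead f a) (lexp J a).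
Proof. exact: asboolP. Qed.

Lemma lead_mon a : lead (mpsmon a) a.
Proof.
split=> [|b ltba] /=; first by rewrite eqxx oner_neq0.
by case: eqP => // eq_ba; rewrite eq_ba lexlt_irr in ltba.
Qed.

Lemma lead_mul f g a b : lead f a -> lead g b -> lead (f * g) (a + b).
Proof.
move=> [fa f0] [gb g0]; split.
  rewrite coefpsM_single ?mulf_neq0 // => u v /lexlt_add_eq[/f0 ->|/g0 ->|[-> ->] //].
    by rewrite mul0r.
  by rewrite mulr0.
move=> c ltc; apply: coefpsM_eq0 => u v cuv; rewrite cuv in ltc.
by have [/f0 ->|/g0 ->] := lexlt_add ltc; rewrite ?mul0r ?mulr0.
Qed.

Lemma lexp_mon J a : mpsmon a \in J -> lexp J a.
Proof. by move=> Ja; apply/lexpP; exists (mpsmon a) => //; apply: lead_mon. Qed.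

Lemma lexp_addr J a b : lexp J b -> lexp J (a + b).
Proof.
move=> /lexpP[g Jg gb]; apply/lexpP; exists (mpsmon a * g).
  exact: ideal_mull.
exact: lead_mul (lead_mon a) gb.
Qed.

Lemma lexp_le J a b : (a <= b)%MM -> lexp J a -> lexp J b.
Proof. by move=> le_ab Ja; rewrite -(submK le_ab); apply: lexp_addr. Qed.

Lemma lexp_sub I J a : {subset I <= J} -> lexp I a -> lexp J a.
Proof.
by move=> sIJ /lexpP[f /sIJ Jf fa]; apply/lexpP; exists f.
Qed.

(** A quantitative stand-in for being primary to the maximal ideal: everything outside the box of
    side [B] is then in [J]. *)
Definition cobounded B J := forall i, mpsX k i ^+ B \in J.

Lemma cobounded_sub B I J : {subset I <= J} -> cobounded B I -> cobounded B J.
Proof. by move=> sIJ Ib i; apply: sIJ. Qed.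

Lemma lexp_unboxed B J a : cobounded B J -> ~~ boxed B a -> lexp J a.
Proof.
move=> Jb; suff out i : (B <= a i)%N -> lexp J a.
  by rewrite /boxed !negb_and -!leqNgt => /or3P[] /out.
move=> le_B; apply: (lexp_le (a := (U_(i) *+ B)%MM)).
  apply/mnm_lepP => j; rewrite mulmnE mnmE.
  by case: eqP => [<-|]; rewrite ?mul0n ?mul1n.
by apply: lexp_mon; rewrite -mpsmonX.
Qed.

Definition restr (p : pred 'X_{1..3}) f : S :=
  MPSeries (fun a => if p a then mpscoef f a else 0).

(** The terms of [f] are sorted by the first coordinate that reaches [B]; each of the three pieces
    is a multiple of the [B]-th power of one variable. *)
Lemma unboxed_mem B J f : cobounded B J ->
  (forall a, boxed B a -> mpscoef f a = 0) -> f \in J.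
Proof.
move=> Jb f0.
have mem i g : (forall a, (a i < B)%N -> mpscoef g a = 0) -> g \in J.
  move=> g0; rewrite (@mpsmon_div _ (U_(i) *+ B)%MM g) => [|a nle].
    by rewrite mulrC; apply: ideal_mull; rewrite -mpsmonX.
  apply: g0; rewrite ltnNge; apply: contra nle => le_B; apply/mnm_lepP => j.
  by rewrite mulmnE mnmE; case: eqP => [<-|]; rewrite ?mul0n ?mul1n.
have -> : f = restr (fun a => B <= a o0)%N f
  + (restr (fun a => (a o0 < B) && (B <= a o1))%N f
  + restr (fun a => (a o0 < B) && (a o1 < B))%N f).
  apply: mpseriesP => a; rewrite !coefpsD /=; case: ltnP => /= _; rewrite ?addr0 //.
  by case: ltnP => /= _; rewrite ?addr0 ?add0r.
apply: ideal_add; first by apply: (mem o0) => a; rewrite /= ltnNge => /negbTE ->.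
apply: ideal_add.
  by apply: (mem o1) => a; rewrite /= (ltnNge (a o1)) => /negbTE ->; rewrite andbF.
apply: (mem o2) => a lta /=; case: ifP => // /andP[lt0 lt1].
by rewrite f0 // /boxed lt0 lt1.
Qed.

(** Division with remainder: the leading term of an element of [J] is cancelled by an element of [I]
    with the same leading exponent, until nothing is left in the box. *)
Lemma lexp_inj B I J : cobounded B I -> {subset I <= J} ->
  (forall a, boxed B a -> lexp J a -> lexp I a) -> {subset J <= I}.
Proof.
move=> Ib sIJ lexpJI f0 Jf0.
(* All boxed coefficients of rank below [r] are already cancelled, and [n] ranks remain to be
   treated. *)
suff main n r f : (r + n = B ^ 3)%N -> f \in J ->
    (forall a, boxed B a -> (lexrank B a < r)%N -> mpscoef f a = 0) -> f \in I.
  exact: (main (B ^ 3)%N 0%N).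
elim: n r f {f0 Jf0} => [|n IHn] r f.
  rewrite addn0 => -> Jf f0; apply: (unboxed_mem Ib) => a ba.
  by rewrite f0 // lexrank_lt.
(* Terms outside the box could precede those inside. Once they are removed, a nonzero coefficient of
   rank [r] is the leading one. *)
move=> rn Jf f0; pose f' := restr (boxed B) f.
have If' : f - f' \in I.
  by apply: (unboxed_mem Ib) => a ba; rewrite coefpsB /= ba subrr.
have Jf' : f' \in J.
  by rewrite -[f'](subKr f); apply: ideal_add => //; apply/ideal_opp/sIJ.
suff If : f' \in I by rewrite -[f](subrK f'); apply: ideal_add.
have rn' : (r.+1 + n = B ^ 3)%N by lia.
have [[a [ba ra fa]]|none] :=
    pselect (exists a, [/\ boxed B a, lexrank B a = r & mpscoef f' a != 0]); last first.
  apply: (IHn r.+1) => // a ba; rewrite ltnS leq_eqVlt => /orP[/eqP ra|lta].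
    by apply/eqP; apply: contrapT => /negP fa; apply: none; exists a.
  by rewrite /= ba f0.
have ltar b : boxed B b -> (lexrank B b < r)%N -> lexlt b a.
  move=> bb ltr; apply: lexlt_total.
    by apply: contraTneq ltr => <-; rewrite ra ltnn.
  by apply/negP => /(lexlt_rank ba bb); rewrite ra ltnNge ltnW.
have /lexpJI-/(_ ba)/lexpP[g Ig [ga g0]] : lexp J a.
  apply/lexpP; exists f' => //; split=> // b ltba /=.
  case: ifP => // bb; apply: f0 => //.
  by rewrite -ra; apply: lexlt_rank.
pose c := mpscoef f' a / mpscoef g a.
have cgE b : mpscoef (MPSeries (fun b => c * mpscoef g b)) b = c * mpscoef g b by [].
have Icg : MPSeries (fun b => c * mpscoef g b) \in I.
  have -> : MPSeries (fun b => c * mpscoef g b) =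
      MPSeries (fun b => if b == 0%MM then c else 0) * g.
    apply: mpseriesP => b; rewrite -[in RHS](add0m b) coefpsM_single /= ?eqxx //.
    move=> u v uv ne; case: eqP => [u0|]; last by rewrite mul0r.
    by case: ne; move: uv; rewrite u0 !add0m => ->.
  exact: ideal_mull.
rewrite -[f'](subrK (MPSeries (fun b => c * mpscoef g b))).
apply: ideal_add => //; apply: (IHn r.+1) => //.
  by apply: ideal_add => //; apply/ideal_opp/sIJ.
move=> b bb; rewrite ltnS leq_eqVlt coefpsB cgE => /orP[/eqP rb|ltb].
  have -> : b = a by apply: (lexrank_eq bb ba); rewrite ra.
  by rewrite divfK // subrr.
by rewrite g0 ?ltar // /= bb f0 // mulr0 subr0.
Qed.

Definition expo B (t : 'I_B * 'I_B * 'I_B) := mnm3 t.1.1 t.1.2 t.2.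

Lemma boxed_expo B (t : 'I_B * 'I_B * 'I_B) : boxed B (expo t).
Proof. by rewrite /boxed !mnm3E !ltn_ord. Qed.

Lemma boxed_expoP B a : boxed B a -> exists t : 'I_B * 'I_B * 'I_B, a = expo t.
Proof.
move=> /and3P[a0 a1 a2]; exists (Ordinal a0, Ordinal a1, Ordinal a2).
by rewrite /expo mnm3K.
Qed.

(** For [cobounded B J] these are all the exponents that do not lead an element of [J], since those
    outside the box do lead one. *)
Definition gaps B J : {set 'I_B * 'I_B * 'I_B} := [set t | ~~ lexp J (expo t)].

Lemma gaps_sub B I J : {subset I <= J} -> gaps B J \subset gaps B I.
Proof.
move=> sIJ; apply/fintype.subsetP => t; rewrite !inE; apply: contra; exact: lexp_sub.
Qed.

Lemma gaps_proper B I J : cobounded B I -> {subset I <= J} ->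
  ~ {subset J <= I} -> gaps B J \proper gaps B I.
Proof.
move=> Ib sIJ nsJI; rewrite properE gaps_sub //=.
apply/negP => /fintype.subsetP sub; apply: nsJI; apply: (lexp_inj Ib sIJ).
move=> a /boxed_expoP[t ->] Jt; apply: contraT => nI.
by have := sub t; rewrite !inE nI Jt => /(_ isT).
Qed.

(** By [gaps_proper] every strict inclusion in the chain uses up at least one gap. *)
Lemma strict_chain_gaps B J n (N : nat -> ideal S) : cobounded B J ->
  {subset J <= N 0%N} -> strict_chain n N -> (n <= #|gaps B J|)%N.
Proof.
move=> Jb sJN chain.
have sub i : (i <= n)%N -> {subset J <= N i}.
  elim: i => // i IHi lti x Jx.
  by have [+ _] := chain _ lti; apply; apply: IHi => //; apply: ltnW.
suff: (n + #|gaps B (N n)| <= #|gaps B (N 0%N)|)%N.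
  move=> le_n; apply: (leq_trans (leq_addr _ _) (leq_trans le_n _)).
  exact/subset_leq_card/gaps_sub.
suff main i : (i <= n)%N -> (i + #|gaps B (N i)| <= #|gaps B (N 0%N)|)%N by exact: main.
elim: i => // i IHi lti; apply: leq_trans (IHi (ltnW lti)).
rewrite addSnnS leq_add2l; have [sN nsN] := chain _ lti.
by apply/proper_card/gaps_proper => //; apply: cobounded_sub (sub i (ltnW lti)) Jb.
Qed.

(** The chain fills one gap at a time, the greatest first: everything above it in the box leads
    already, so enlarging the ideal there creates no other leading exponent. *)
Lemma chain_gaps B J : cobounded B J ->
  exists2 N : nat -> ideal S, N 0%N = J & strict_chain #|gaps B J| N.
Proof.
move=> Jb; suff main n : (n <= #|gaps B J|)%N ->
  exists2 N : nat -> ideal S, N 0%N = J & strict_chain n N by exact: main.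
elim: n J Jb => [|n IHn] J Jb len; first by exists (fun=> J).
have /card_gt0P[t0 t0in] : (0 < #|gaps B J|)%N by apply: leq_trans len.
pose t := [arg max_(t > t0 in gaps B J) lexrank B (expo t)].
have [tin tmax] : t \in gaps B J /\
    forall s, s \in gaps B J -> (lexrank B (expo s) <= lexrank B (expo t))%N.
  by rewrite /t; case: arg_maxnP.
pose b := expo t; have nb : ~~ lexp J b by move: tin; rewrite inE.
have downT u v : lexlt (u + v) b -> lexlt v b by exact: lexlt_addr.
(* [J'] adds to [J] all series without terms below [b], in particular the monomial of [b]. *)
pose J' := agree (T := fun a => lexlt a b) J downT.
have sJJ' : {subset J <= J'} by exact: agree_sub.
have J'b : mpsmon b \in J'.
  apply/agreeP; exists 0; first exact: rpred0.
  by move=> a; apply: (lead_mon b).2.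
have lexpJ' a : boxed B a -> lexp J' a -> a = b \/ lexp J a.
  move=> /boxed_expoP[s ->] /lexpP[h /agreeP[f Jf hf] [ha h0]].
  have [ltab|nlt] := boolP (lexlt (expo s) b).
    right; apply/lexpP; exists f => //; split; first by rewrite -hf.
    by move=> c ltc; rewrite -hf ?h0 //; apply: lexlt_trans ltab.
  have [->|ne] := eqVneq (expo s) b; [by left|right].
  have := lexlt_total ne nlt => /(lexlt_rank (boxed_expo t) (boxed_expo s)) ltr.
  apply: contraT => nlexp; have := tmax s; rewrite inE nlexp => /(_ isT).
  by rewrite leqNgt ltr.
have [||N N0 chain] := IHn J'; first exact: cobounded_sub Jb.
  have : gaps B J :\ t \subset gaps B J'.
    apply/fintype.subsetP => s; rewrite !inE => /andP[ne nJs].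
    apply/negP => /(lexpJ' _ (boxed_expo s))[eq_s|Js]; last by rewrite Js in nJs.
    case/eqP: ne; have := congr1 (fun a => (a o0, a o1, a o2)) eq_s.
    rewrite /b /expo !mnm3E.
    case: s t {tin tmax b nb J' sJJ' J'b lexpJ' eq_s downT nJs}
      => [[s0 s1] s2] [[t0' t1] t2] /= [e0 e1 e2].
    by congr (_, _, _); apply: val_inj.
  by move=> /subset_leq_card; move: len; rewrite (cardsD1 t (gaps B J)) tin; lia.
exists (fun i => if i is i'.+1 then N i' else J) => // -[|i] lti; last exact: chain.
rewrite N0; split=> // sJ'J; move/negP: nb; apply; apply: lexp_mon.
exact: sJ'J.
Qed.

End LeadingExponents.

(** * Length of a quotient by chains of ideals above [J] *)

Section Quotient.
Local Open Scope ring_scope.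
Local Open Scope quotient_scope.
Variables (A : comNzRingType) (J : ideal A).
Local Notation Q := {ideal_quot J}.

Lemma pi_quotD : {morph (\pi_Q : A^o -> Q) : x y / x + y}.
Proof. exact: Quotient.pi_add. Qed.

Lemma pi_quot0 : \pi_Q (0 : A^o) = 0.
Proof. by rewrite [RHS]/GRing.zero /= /Quotient.zero -lock. Qed.

Section Pull.
Variable N : submodule Q.

Definition pull_pred : {pred A^o} := fun x => \pi_Q x \in N.

Lemma pull_closed : GRing.submod_closed pull_pred.
Proof.
split=> [|a x y]; rewrite /in_mem /= /pull_pred.
  by rewrite pi_quot0; apply: (@rpred0 Q N).
move=> Nx Ny; rewrite pi_quotD -pi_quot_scale.
by apply: (@rpredD Q N) => //; apply: (@rpredZ A Q N).
Qed.

Definition pull : ideal A := Submodule pull_closed.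

End Pull.

Section Push.
Variables (K : ideal A) (sJK : {subset J <= K}).

Definition push_pred : {pred Q} := fun y => repr y \in K.

(** As [J] lies in [K], the choice of representative in [push_pred] does not matter. *)
Lemma pi_push (x : A^o) : (\pi_Q x \in push_pred) = (x \in K).
Proof.
have Kd : x - repr (\pi_Q x) \in K.
  by apply: sJK; rewrite Quotient.idealrBE reprK.
rewrite {1}/in_mem /= /push_pred; apply/idP/idP => Kx.
  by rewrite -[x](subrK (repr (\pi_Q x))) rpredD.
by rewrite -[repr _](subKr x) rpredB.
Qed.

Lemma push_closed : GRing.submod_closed push_pred.
Proof.
split=> [|a x y].
  by rewrite -pi_quot0 pi_push rpred0.
rewrite -[x]reprK -[y]reprK !pi_push => Kx Ky.
by rewrite [_ *: _]pi_quot_scale -pi_quotD pi_push rpredD ?rpredZ.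
Qed.

Definition push : submodule Q := Submodule push_closed.

End Push.

(** Submodules of the quotient correspond to ideals containing [J]: [pull] carries chains up for the
    upper bound, [push] carries the given chain down for the lower one. *)
Lemma mlength_quot (R : realType) (n : nat) :
  (forall m (N : nat -> ideal A),
    {subset J <= N 0%N} -> strict_chain m N -> (m <= n)%N) ->
  (exists2 N : nat -> ideal A, N 0%N = J & strict_chain n N) ->
  mlength R Q = (n%:R)%:E.
Proof.
move=> ub [N N0 chain]; apply/eqP; rewrite eq_le; apply/andP; split.
  apply: ge_ereal_sup => _ [m [M Mchain] <-]; rewrite lee_fin ler_nat.
  apply: (ub m (fun i => pull (M i))) => [x Jx|i lti].
    rewrite /in_mem /= /pull_pred.
    suff -> : \pi_Q x = 0 by exact: (@rpred0 Q (M 0%N)).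
    rewrite -pi_quot0.
    by apply/eqP; rewrite -Quotient.idealrBE subr0.
  have [sM nsM] := Mchain _ lti; split=> [x|sub]; first exact: sM.
  by apply: nsM => y; rewrite -[y]reprK; apply: sub.
have sub i : (i <= n)%N -> {subset J <= N i}.
  elim: i => [_|i IHi lti x Jx]; first by rewrite N0.
  by have [+ _] := chain _ lti; apply; apply: IHi => //; apply: ltnW.
(* The chain is controlled only up to index [n], whereas [push] needs an ideal containing [J] at
   every index; so the index is capped. *)
have sub' i : {subset J <= N (minn i n)} by apply: sub; apply: geq_minr.
apply: ereal_sup_ubound; exists n => //; exists (fun i => push (sub' i)) => i lti.
have [sN nsN] := chain _ lti.
have mi : minn i n = i by apply/minn_idPl/ltnW.
have mi1 : minn i.+1 n = i.+1 by apply/minn_idPl.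
split=> [y|sN'].
  by rewrite -[y]reprK !(pi_push (sub' _)) mi mi1; apply: sN.
by apply: nsN => x Nx; have := sN' (\pi_Q x); rewrite !(pi_push (sub' _)) mi mi1; apply.
Qed.

End Quotient.

Lemma mlength_gaps (R : realType) (k : fieldType) B (J : ideal (mpseries 3 k)) :
  cobounded B J -> mlength R {ideal_quot J} = (#|gaps B J|%:R)%:E.
Proof.
move=> Jb; apply: mlength_quot; last exact: chain_gaps.
by move=> m N; apply: strict_chain_gaps.
Qed.

(** * Triangulation of a staircase *)

Section Height.
Local Open Scope nat_scope.
Implicit Types (e : nat -> nat -> nat -> bool).

(** For [e] upward closed in its first argument this is the least [i] with [e i j l], or [B] if
    there is none below [B]; counting makes sums of heights into numbers of gaps. *)
Definition height B e j l := \sum_(i < B) ~~ e i j l.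

Lemma height_le B e j l n : (forall i, n <= i -> e i j l) -> height B e j l <= n.
Proof.
move=> en; rewrite /height; elim: B => [|B IHB]; first by rewrite big_ord0.
rewrite big_ord_recr /=; have [/en ->|ltB] := leqP n B; first by rewrite addn0.
apply: leq_trans (_ : B + 1 <= _).
  apply: leq_add; last exact: leq_b1.
  by rewrite -[leqRHS](card_ord B) -sum1_card leq_sum // => i _; apply: leq_b1.
by rewrite addn1.
Qed.

(** Otherwise every index up to and including the height would be counted, one more than the height
    itself. *)
Lemma height_mem B e j l : (forall i i', i <= i' -> e i j l -> e i' j l) ->
  e B j l -> e (height B e j l) j l.
Proof.
move=> mono eB; apply: contraT => nH.
have ltHB : height B e j l < B.
  by rewrite ltnNge; apply: contra nH => /mono; apply.
have : (height B e j l).+1 <= height B e j l; last by rewrite ltnn.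
rewrite {2}/height (bigID (fun i : 'I_B => i < (height B e j l).+1)) /=.
apply: leq_trans (leq_addr _ _).
rewrite (eq_bigr (fun=> 1)) => [|i lti]; last first.
  by rewrite (contra (@mono i _ _) nH).
by rewrite -(big_ord_widen B (fun=> 1)) // sum1_card card_ord.
Qed.

Lemma sum_mul_split q B (F : nat -> nat) :
  \sum_(j < B * q) F j = \sum_(i < B) \sum_(u < q) F (i * q + u).
Proof.
elim: B => [|B IHB]; first by rewrite mul0n !big_ord0.
by rewrite mulSnr big_split_ord big_ord_recr /= IHB.
Qed.

Lemma sum_bin n m : \sum_(i < n) 'C(i, m) = 'C(n, m.+1).
Proof.
by elim: n => [|n IHn]; rewrite ?big_ord0 // big_ord_recr /= IHn binS.
Qed.

Lemma sum_subn_diag u q : u <= q -> \sum_(v < q) (u + v - q) = 'C(u, 2).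
Proof.
move=> le_uq; rewrite -(subnK le_uq); set d := q - u.
rewrite big_split_ord /= big1 => [|i _]; last by have := ltn_ord i; lia.
rewrite add0n (eq_bigr (fun i : 'I_u => 'C(i, 1))) ?sum_bin // => i _.
by rewrite bin1; lia.
Qed.

(** The total interpolation weights, over the [q ^ 2] points of a subdivided square, of its far
    corner, of a corner on the cutting diagonal and of its near corner; asymptotically [q ^ 3] times
    1/6, 1/3 and 1/6. *)
Definition tri_hi q := \sum_(u < q) \sum_(v < q) (u + v - q).
Definition tri_mid q := \sum_(u < q) \sum_(v < q) minn u (q - v).
Definition tri_lo q := \sum_(u < q) \sum_(v < q) (q - (u + v)).

Lemma bin3 q : 'C(q, 3) * 6 + 3 * q ^ 2 = q ^ 3 + 2 * q.
Proof.
rewrite -[6]/(3`!) bin_ffact; case: q => [|[|[|q]]] //.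
rewrite !ffactnS ffactn0 /= !expnS expn0; nia.
Qed.

Lemma bin2_double q : 'C(q, 2) * 2 + q = q ^ 2.
Proof.
rewrite -[X in _ * X]/(2`!) bin_ffact; case: q => [|q] //.
rewrite !ffactnS ffactn0 /= !expnS expn0; nia.
Qed.

Lemma tri_hiE q : tri_hi q = 'C(q, 3).
Proof.
rewrite /tri_hi -sum_bin; apply: eq_bigr => u _; apply: sum_subn_diag.
exact: ltnW.
Qed.

(** Pointwise, [minn u (q - v)] and the truncated [u + v - q] add up to [u]. *)
Lemma tri_midE q : tri_mid q + tri_hi q = q * 'C(q, 2).
Proof.
rewrite -big_split /= -sum_bin big_distrr /=; apply: eq_bigr => u _.
have -> : q * 'C(u, 1) = \sum_(v < q) u by rewrite sum_nat_const card_ord bin1.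
by rewrite -big_split; apply: eq_bigr => v _ /=; have := ltn_ord v; lia.
Qed.

(** Pointwise, the truncated difference [q - (u + v)] plus [u + v] equals [q] plus the truncated
    [u + v - q]. *)
Lemma tri_loE q : tri_lo q = q ^ 2 + tri_hi q.
Proof.
have : tri_lo q + (q * 'C(q, 2) + q * 'C(q, 2)) = q * (q * q) + tri_hi q.
  have e1 : q * 'C(q, 2) = \sum_(u < q) \sum_(v < q) u.
    rewrite -sum_bin big_distrr /=; apply: eq_bigr => u _.
    by rewrite sum_nat_const card_ord bin1.
  have e2 : q * 'C(q, 2) = \sum_(u < q) \sum_(v < q) v.
    by rewrite e1 exchange_big.
  have -> : q * (q * q) = \sum_(u < q) \sum_(v < q) q.
    by rewrite !sum_nat_const !card_ord.
  rewrite {1}e1 e2 /tri_lo /tri_hi -!big_split; apply: eq_bigr => u _ /=.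
  by rewrite -!big_split; apply: eq_bigr => v _ /=; lia.
by have := bin2_double q; rewrite !expnS expn0; nia.
Qed.

(** The value is [q * (q + 1) * (q + 2)]: [tri_lo q] also counts the monomials of degree below [q]
    in three variables, the use made of it for powers of the maximal ideal. *)
Lemma tri_lo6 q : 6 * tri_lo q = q ^ 3 + 3 * q ^ 2 + 2 * q.
Proof. by rewrite tri_loE tri_hiE; have := bin3 q; lia. Qed.

Lemma sum_subn_ord n : 2 * \sum_(z < n) (n - z) = n ^ 2 + n.
Proof.
have : \sum_(z < n) (n - z) + \sum_(z < n) z = \sum_(z < n) n.
  by rewrite -big_split; apply: eq_bigr => z _ /=; rewrite subnK // ltnW.
rewrite sum_nat_const card_ord.
have -> : \sum_(z < n) z = 'C(n, 2).
  by rewrite -sum_bin; apply: eq_bigr => z _; rewrite bin1.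
have := bin2_double n; rewrite !expnS expn0; lia.
Qed.

(* Each lattice square is cut along the diagonal (1,0)--(0,1); the weights are
   the barycentric coordinates of (u/q, v/q) in its triangle, times q. *)
Lemma height_interp q B B' e e' i j u v :
  (forall x x' y z, x <= x' -> e x y z -> e x' y z) ->
  (forall y z, e B y z) ->
  (forall x x' y z, x <= x' -> e' x y z -> e' x' y z) ->
  (forall t1 t2 t3 x1 y1 z1 x2 y2 z2 x3 y3 z3, t1 + t2 + t3 = q ->
    e x1 y1 z1 -> e x2 y2 z2 -> e x3 y3 z3 ->
    e' (t1 * x1 + t2 * x2 + t3 * x3) (t1 * y1 + t2 * y2 + t3 * y3)
       (t1 * z1 + t2 * z2 + t3 * z3)) ->
  u < q -> v < q ->
  height B' e' (i * q + u) (j * q + v) <=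
    (q - (u + v)) * height B e i j + minn u (q - v) * height B e i.+1 j +
    minn v (q - u) * height B e i j.+1 + (u + v - q) * height B e i.+1 j.+1.
Proof.
move=> mono eB mono' comb ltu ltv; pose h := height B e.
have hP y z : e (h y z) y z by apply: height_mem => // x x'; apply: mono.
(* The point is a sum of [q] vertices of its triangle, with the weights as multiplicities. [comb]
   then puts the weighted sum of the heights at these vertices into [e']. *)
apply: height_le => x; have [le_q|lt_q] := leqP (u + v) q.
- move=> /mono'; apply; have -> : i * q + u = (q - (u + v)) * i + u * i.+1 + v * i by nia.
  have -> : j * q + v = (q - (u + v)) * j + u * j + v * j.+1 by nia.
  rewrite -/h (minn_idPl _); last by lia.
  rewrite (minn_idPl _); last by lia.
  have -> : u + v - q = 0 by lia.
  rewrite mul0n addn0; apply: comb => //; lia.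
- move=> /mono'; apply.
  have -> : i * q + u = (q - v) * i.+1 + (q - u) * i + (u + v - q) * i.+1 by nia.
  have -> : j * q + v = (q - v) * j + (q - u) * j.+1 + (u + v - q) * j.+1 by nia.
  rewrite -/h (minn_idPr _); last by lia.
  rewrite (minn_idPr _); last by lia.
  have -> : q - (u + v) = 0 by lia.
  rewrite mul0n add0n; apply: comb => //; lia.
Qed.

(* Six times the volume under the interpolation of the heights. *)
Definition hull_weight B e :=
  \sum_(i < B) \sum_(j < B) height B e i j +
  2 * (\sum_(i < B) \sum_(j < B) height B e i.+1 j +
       \sum_(i < B) \sum_(j < B) height B e i j.+1) +
  \sum_(i < B) \sum_(j < B) height B e i.+1 j.+1.

(** Summation of [height_interp] over all squares. Only the near corner has a total weight beyond
    its share of [q ^ 3], and its excess gives the quadratic error term. *)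
Lemma sum_height_le q B e e' :
  (forall x x' y z, x <= x' -> e x y z -> e x' y z) ->
  (forall y z, e B y z) ->
  (forall x x' y z, x <= x' -> e' x y z -> e' x' y z) ->
  (forall t1 t2 t3 x1 y1 z1 x2 y2 z2 x3 y3 z3, t1 + t2 + t3 = q ->
    e x1 y1 z1 -> e x2 y2 z2 -> e x3 y3 z3 ->
    e' (t1 * x1 + t2 * x2 + t3 * x3) (t1 * y1 + t2 * y2 + t3 * y3)
       (t1 * z1 + t2 * z2 + t3 * z3)) ->
  6 * \sum_(i < B * q) \sum_(j < B * q) height (B * q) e' i j <=
    q ^ 3 * hull_weight B e +
    (3 * q ^ 2 + 2 * q) * \sum_(i < B) \sum_(j < B) height B e i j.
Proof.
move=> mono eB mono' comb; set h' := height (B * q) e'; pose h := height B e.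
have -> : \sum_(i < B * q) \sum_(j < B * q) h' i j =
    \sum_(i < B) \sum_(j < B) \sum_(u < q) \sum_(v < q) h' (i * q + u) (j * q + v).
  rewrite (sum_mul_split q B (fun i => \sum_(j < B * q) h' i j)).
  apply: eq_bigr => i _; rewrite [RHS]exchange_big /=; apply: eq_bigr => u _.
  exact: (sum_mul_split q B (h' (i * q + u))).
have le_sq (i j : 'I_B) : \sum_(u < q) \sum_(v < q) h' (i * q + u) (j * q + v) <=
    tri_lo q * h i j + tri_mid q * h i.+1 j + tri_mid q * h i j.+1 +
    tri_hi q * h i.+1 j.+1.
  have -> : tri_mid q * h i j.+1 =
      (\sum_(u < q) \sum_(v < q) minn v (q - u)) * h i j.+1.
    by rewrite exchange_big.
  rewrite /tri_lo /tri_mid /tri_hi !big_distrl -!big_split /=.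
  apply: leq_sum => u _; rewrite !big_distrl -!big_split /=; apply: leq_sum => v _.
  by apply: height_interp.
apply: (@leq_trans (6 * \sum_(i < B) \sum_(j < B) (tri_lo q * h i j +
   tri_mid q * h i.+1 j + tri_mid q * h i j.+1 + tri_hi q * h i.+1 j.+1))).
  by rewrite leq_mul2l /=; apply: leq_sum => i _; apply: leq_sum => j _.
have sumE : \sum_(i < B) \sum_(j < B) (tri_lo q * h i j +
   tri_mid q * h i.+1 j + tri_mid q * h i j.+1 + tri_hi q * h i.+1 j.+1) =
  tri_lo q * \sum_(i < B) \sum_(j < B) h i j +
  tri_mid q * \sum_(i < B) \sum_(j < B) h i.+1 j +
  tri_mid q * \sum_(i < B) \sum_(j < B) h i j.+1 +
  tri_hi q * \sum_(i < B) \sum_(j < B) h i.+1 j.+1.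
  rewrite !big_distrr -!big_split /=; apply: eq_bigr => i _.
  by rewrite !big_distrr -!big_split.
rewrite {}sumE /hull_weight -/h.
move: (\sum_(i < B) \sum_(j < B) h i j) (\sum_(i < B) \sum_(j < B) h i.+1 j)
  (\sum_(i < B) \sum_(j < B) h i j.+1) (\sum_(i < B) \sum_(j < B) h i.+1 j.+1).
move=> H00 H10 H01 H11.
have mid := tri_midE q; have hi := tri_hiE q.
have b3 := bin3 q; have b2 := bin2_double q.
have hi6 : 6 * tri_hi q <= q ^ 3 by rewrite hi; move: b3; rewrite !expnS expn0; nia.
have lo6 : 6 * tri_lo q = q ^ 3 + (3 * q ^ 2 + 2 * q) by rewrite tri_lo6 addnA.
have mid6 : 6 * tri_mid q <= 2 * q ^ 3.
  have : 6 * tri_mid q + 'C(q, 3) * 6 = 3 * (q * ('C(q, 2) * 2)).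
    by rewrite -hi; lia.
  have : 3 * (q * ('C(q, 2) * 2)) + 3 * q ^ 2 = 3 * q ^ 3.
    by rewrite [in RHS]expnS -b2; lia.
  by move: b3; lia.
rewrite !mulnDr !mulnA lo6 !mulnDl.
have /(leq_mul (leqnn H10)) := mid6; have /(leq_mul (leqnn H01)) := mid6.
have /(leq_mul (leqnn H11)) := hi6.
by rewrite -[6 * tri_mid q]mulnC; lia.
Qed.

(** Heights vanish at [B], so shifting an index by one just drops the terms on an axis. The double
    shift drops both axes but their common corner only once, whence the last term. *)
Lemma hull_weightE B e : (forall x y, e x B y) -> (forall x y, e x y B) -> 0 < B ->
  hull_weight B e + 3 * \sum_(j < B) height B e 0 j + 3 * \sum_(i < B) height B e i 0 =
  6 * \sum_(i < B) \sum_(j < B) height B e i j + height B e 0 0.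
Proof.
move=> eB1 eB2 B0; rewrite /hull_weight; pose h := height B e.
have hB1 j : h B j = 0 by rewrite /h /height big1 // => i _; rewrite eB1.
have hB2 i : h i B = 0 by rewrite /h /height big1 // => j _; rewrite eB2.
have shift (F : nat -> nat) : F B = 0 -> \sum_(i < B) F i.+1 + F 0 = \sum_(i < B) F i.
  move=> FB; rewrite addnC -[LHS](big_ord_recl B (fun i => F i)).
  by rewrite big_ord_recr /= FB addn0.
have s1 : \sum_(i < B) \sum_(j < B) h i.+1 j + \sum_(j < B) h 0 j =
    \sum_(i < B) \sum_(j < B) h i j.
  by rewrite (shift (fun i => \sum_(j < B) h i j)) // big1.
have s2 : \sum_(i < B) \sum_(j < B) h i j.+1 + \sum_(i < B) h i 0 =
    \sum_(i < B) \sum_(j < B) h i j.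
  by rewrite -big_split /=; apply: eq_bigr => i _; rewrite shift.
have s3 : \sum_(i < B) \sum_(j < B) h i.+1 j.+1 + \sum_(i < B) h i.+1 0 =
    \sum_(i < B) \sum_(j < B) h i.+1 j.
  by rewrite -big_split /=; apply: eq_bigr => i _; rewrite shift.
have s4 : \sum_(i < B) h i.+1 0 + h 0 0 = \sum_(i < B) h i 0.
  exact: (shift (fun i => h i 0)).
rewrite -/h; lia.
Qed.

End Height.

(** * Convergence of the Hilbert-Samuel ratio *)

Section Limit.
Local Open Scope classical_set_scope.
Local Open Scope ring_scope.
Variable R : realType.

Lemma cvg_invn : (n%:R^-1 : R) @[n --> \oo] --> (0 : R).
Proof.
by have := @cvg_harmonic R; rewrite /harmonic (cvg_shiftS (fun n => n%:R^-1 : R)).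
Qed.

(** A Fekete argument: the limit is the infimum of the ratios. Rounding [n] up to a multiple of [p]
    compares the ratio at [n] with the one at [p]. *)
Lemma cvg_cube_ratio (c : nat -> nat) :
  {homo c : m n / (m <= n)%N} ->
  (forall p q, (c (p * q) <= (q ^ 3 + q ^ 2) * c p)%N) ->
  cvgn (fun n => (c n)%:R / n%:R ^+ 3 : R).
Proof.
move=> mono submul; pose v n : R := (c n)%:R / n%:R ^+ 3.
(* Index 0 is excluded: division by zero gives [v 0 = 0], which would make the infimum 0. *)
pose E := [set v p | p in [set p | (0 < p)%N]].
have v0 n : 0 <= v n by rewrite /v divr_ge0 // exprn_ge0.
have infE : has_inf E.
  by split; [exists (v 1%N), 1%N | exists 0 => _ [p _ <-]].
apply/cvg_ex; exists (inf E); apply/cvgrPdist_le => e e0.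
have [_ [p /= p0 <-] ltv] := inf_adherent e0 infE.
(* This is [q ^ 2 * (q + 1) * c p / n ^ 3] with [q] replaced by its upper bound [n / p + 1]. *)
pose g n : R := (p%:R^-1 + n%:R^-1) ^+ 2 * (p%:R^-1 + 2 * n%:R^-1) * (c p)%:R.
have gv : g n @[n --> \oo] --> v p.
  have -> : v p = (p%:R^-1 + 0) ^+ 2 * (p%:R^-1 + 2 * 0) * (c p)%:R.
    by rewrite /v mulr0 !addr0 -exprSr exprVn mulrC.
  have vn := cvg_invn.
  apply: cvgM; last exact: cvg_cst.
  apply: cvgM.
    by rewrite expr2; under eq_fun do rewrite expr2; apply: cvgM;
      apply: cvgD => //; apply: cvg_cst.
  by apply: cvgD; [exact: cvg_cst | apply: cvgM => //; exact: cvg_cst].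
have vg n : (0 < n)%N -> v n <= g n.
  move=> n0; pose q := (n %/ p).+1.
  have le_n : (n <= p * q)%N by rewrite mulnC ltnW // ltn_ceil.
  have p0' : 0 < p%:R :> R by rewrite ltr0n.
  have n0' : 0 < n%:R :> R by rewrite ltr0n.
  have le_q : q%:R <= n%:R / p%:R + 1 :> R.
    rewrite -natr1 lerD2r ler_pdivlMr // -natrM ler_nat; exact: leq_divM.
  rewrite /v ler_pdivrMr ?exprn_gt0 //.
  apply: (@le_trans _ _ ((q%:R ^+ 2 * (q%:R + 1)) * (c p)%:R)).
    rewrite -natrX natr1 -!natrM ler_nat.
    apply: leq_trans (mono _ _ le_n) (leq_trans (submul _ _) _).
    by rewrite leq_mul2r; lia.
  have -> : g n * n%:R ^+ 3 =
      (n%:R / p%:R + 1) ^+ 2 * ((n%:R / p%:R + 1) + 1) * (c p)%:R.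
    by rewrite /g; field; rewrite !gt_eqF.
  by rewrite ler_wpM2r // ler_pM ?exprn_ge0 ?addr_ge0 // ?lerXn2r ?nnegrE
    ?addr_ge0 ?divr_ge0 ?lerD2r.
near=> n; have n0 : (0 < n)%N by near: n; exact: nbhs_infty_gt.
have lo : inf E <= v n by apply: ge_inf; [exact: infE.2 | exists n].
rewrite distrC ger0_norm ?subr_ge0 // lerBlDl (le_trans (vg n n0)) // ltW //.
by near: n; apply: (cvgr_lt (v p)).
Unshelve. all: by end_near.
Qed.

End Limit.

(** * Powers of ideals *)

Section Powers.
Local Open Scope ring_scope.
Variable k : comNzRingType.
Local Notation S := (mpseries 3 k).
Implicit Types (f g : S) (I J : ideal S).

Section Colon.
Variables (J : ideal S) (g : S).

Definition colon_pred : {pred S^o} := fun f => (f : S) * g \in J.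

Lemma colon_closed : GRing.submod_closed colon_pred.
Proof.
split=> [|x f h]; rewrite /in_mem /= /colon_pred.
  by rewrite mul0r; apply: (@rpred0 S^o J).
rewrite mulrDl => fJ hJ; apply: ideal_add => //.
by rewrite -[x *: f]/(x * f : S) -mulrA; apply: ideal_mull.
Qed.

Definition colon : ideal S := Submodule colon_closed.

Lemma colonP f : (f \in colon) = (f * g \in J).
Proof. by []. Qed.

End Colon.

(** Through the colon ideal of [g] the claim becomes an inclusion of ideals, which can be checked on
    generators. *)
Lemma idealX_mul I n m f g :
  f \in idealX I n -> g \in idealX I m -> f * g \in idealX I (n + m).
Proof.
move=> + Ig; suff sub : {subset idealX I n <= colon (idealX I (n + m)) g} by apply: sub.
elim: n => [|n IHn]; apply: idgen_sub => x; first by move=> ->; rewrite colonP mul1r.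
move=> [y Iy [z Iz ->]]; rewrite colonP -mulrA; apply: idealM_mem => //.
by have := IHn _ Iz; rewrite colonP.
Qed.

Lemma idealX_anti I n m : (n <= m)%N -> {subset idealX I m <= idealX I n}.
Proof.
move=> /subnK <-; elim: (m - n)%N => [//|d IHd] f.
by rewrite addSn => /idealM_subr /IHd.
Qed.

Section Vanish.
Variable (T : 'X_{1..3} -> Prop).
Hypothesis downT : forall u v, T (u + v)%MM -> T v.

Definition vanish : ideal S := agree (idgen set0) downT.

Lemma idgen0 f : f \in idgen (set0 : set S) -> f = 0.
Proof.
have closed0 : GRing.submod_closed (fun f : S^o => f == 0).
  split=> [|a x y]; first exact: eqxx.
  by move=> /eqP -> /eqP ->; rewrite scaler0 addr0; apply: eqxx.
have /(_ f) sub : {subset idgen (set0 : set S) <= Submodule closed0} by apply: idgen_sub.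
by move=> /sub /eqP.
Qed.

Lemma vanishP f : (f \in vanish) <-> (forall a, T a -> mpscoef f a = 0).
Proof.
split=> [/agreeP[g /idgen0 -> //]|f0]; apply/agreeP.
by exists 0 => //; apply: (@rpred0 S^o).
Qed.

End Vanish.

Lemma mdeg_down n (u v : 'X_{1..3}) : (mdeg (u + v) < n)%N -> (mdeg v < n)%N.
Proof. by rewrite mdegD; lia. Qed.

(** An ideal containing the [n]-th power of the maximal ideal in which membership is read off the
    coefficients. *)
Definition orderge n : ideal S := vanish (T := fun a => (mdeg a < n)%N) (@mdeg_down n).

Lemma ordergeP n f :
  f \in orderge n <-> (forall a, (mdeg a < n)%N -> mpscoef f a = 0).
Proof. exact: vanishP. Qed.

Lemma orderge_mul n m f g :
  f \in orderge n -> g \in orderge m -> f * g \in orderge (n + m).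
Proof.
move=> /ordergeP f0 /ordergeP g0; apply/ordergeP => a lta.
apply: coefpsM_eq0 => u v auv; move: lta; rewrite auv mdegD => lta.
have [/f0 ->|le_nu] := ltnP (mdeg u) n; first by rewrite mul0r.
by rewrite g0 ?mulr0 //; lia.
Qed.

Lemma orderge_idealX I n q :
  {subset I <= orderge n} -> {subset idealX I q <= orderge (n * q)}.
Proof.
move=> sub; elim: q => [|q IHq] f; first by move=> _; apply/ordergeP => a; rewrite muln0.
move: f; rewrite mulnS; apply: idgen_sub => x [y Iy [z Iz ->]].
by apply: orderge_mul; [apply: sub | apply: IHq].
Qed.

Lemma mps_max_X i : mpsX k i \in mps_max 3 k.
Proof. by apply: idgen_mem; exists i. Qed.

Lemma mps_max_order : {subset mps_max 3 k <= orderge 1}.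
Proof.
apply: idgen_sub => _ [i _ <-]; apply/ordergeP => a.
rewrite ltnS leqn0 mdeg_eq0 => /eqP ->; rewrite /=; case: eqP => // /esym/eqP.
by rewrite mnm1_eq0.
Qed.

Lemma mpsmon_mem x y z : mpsmon (mnm3 x y z) \in idealX (mps_max 3 k) (x + y + z).
Proof.
have -> : mnm3 x y z = (U_(o0) *+ x + U_(o1) *+ y + U_(o2) *+ z)%MM.
  apply: mnm3P; rewrite mnm3E !mnmDE !mulmnE !mnm1E -!val_eqE /= !inordK //=; lia.
rewrite !mpsmonD -!mpsmonX.
by do 2?[apply: idealX_mul]; apply: idealX_mem; apply: mps_max_X.
Qed.

End Powers.

(** * Counting gaps by columns, and the Hilbert-Samuel function *)

Section Gaps.
Local Open Scope nat_scope.
Variable k : fieldType.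
Local Notation S := (mpseries 3 k).
Implicit Types (f g h : S) (I J K : ideal S).

Definition exps J x y z := lexp J (mnm3 x y z).

Lemma exps_mono J x x' y y' z z' :
  x <= x' -> y <= y' -> z <= z' -> exps J x y z -> exps J x' y' z'.
Proof.
by move=> lex ley lez; apply: lexp_le; rewrite mnm3_le !mnm3E lex ley lez.
Qed.

Lemma exps_out B J x y z : cobounded B J ->
  [|| B <= x, B <= y | B <= z] -> exps J x y z.
Proof.
move=> Jb out; apply: (lexp_unboxed Jb).
by rewrite /boxed !mnm3E !negb_and -!leqNgt.
Qed.

Lemma card_gaps B J :
  #|gaps B J| = \sum_(y < B) \sum_(z < B) height B (exps J) y z.
Proof.
rewrite -sum1_card big_mkcond /=.
transitivity (\sum_(t : 'I_B * 'I_B * 'I_B) ~~ exps J t.1.1 t.1.2 t.2).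
  by apply: eq_bigr => t _; rewrite inE /exps /expo; case: (lexp _ _).
rewrite -(pair_bigA _ (fun (p : 'I_B * 'I_B) (z : 'I_B) =>
  nat_of_bool (~~ exps J p.1 p.2 z))) /=.
rewrite -(pair_bigA _ (fun x y : 'I_B => \sum_(z < B) ~~ exps J x y z)) /=.
rewrite exchange_big; apply: eq_bigr => y _ /=.
by rewrite exchange_big; apply: eq_bigr => z _.
Qed.

Lemma height_sub B (e e' : nat -> nat -> nat -> bool) y z :
  (forall x, e x y z -> e' x y z) -> height B e' y z <= height B e y z.
Proof.
move=> sub; apply: leq_sum => x _; have := sub x.
by case: (e _ _ _) => [->|] //; case: (e' _ _ _).
Qed.

Lemma height_eq0 B (e : nat -> nat -> nat -> bool) y z :
  (forall x, e x y z) -> height B e y z = 0.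
Proof. by move=> ex; apply: big1 => x _; rewrite ex. Qed.

Lemma height_ge B (e : nat -> nat -> nat -> bool) y z n :
  n <= B -> (forall x, e x y z -> n <= x) -> n <= height B e y z.
Proof.
move=> le_nB en; rewrite /height (bigID (fun x : 'I_B => x < n)) /=.
apply: leq_trans (leq_addr _ _).
rewrite (eq_bigr (fun=> 1)) => [|x ltx]; last first.
  by have := en x; case: (e _ _ _) => // /(_ isT); rewrite leqNgt ltx.
by rewrite -(big_ord_widen B (fun=> 1)) // sum1_card card_ord.
Qed.

Lemma card_gaps_y B J : 0 < B -> (forall x y z, exps J x y.+1 z) ->
  #|gaps B J| = \sum_(z < B) height B (exps J) 0 z.
Proof.
case: B => // B _ ey; rewrite card_gaps big_ord_recl /= [X in _ + X]big1 ?addn0 // => y _.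
by apply: big1 => z _; apply: height_eq0 => x; apply: ey.
Qed.

Lemma card_gaps_z B J : 0 < B -> (forall x y z, exps J x y z.+1) ->
  #|gaps B J| = \sum_(y < B) height B (exps J) y 0.
Proof.
case: B => // B _ ez; rewrite card_gaps; apply: eq_bigr => y _.
rewrite big_ord_recl /= [X in _ + X]big1 ?addn0 // => z _.
by apply: height_eq0 => x; apply: ez.
Qed.

Lemma card_gaps_yz B J : 0 < B -> (forall x y z, exps J x y.+1 z) ->
  (forall x y z, exps J x y z.+1) -> #|gaps B J| = height B (exps J) 0 0.
Proof.
move=> B0 ey ez; rewrite card_gaps_y //; case: B B0 => // B _.
rewrite big_ord_recl /= [X in _ + X]big1 ?addn0 // => z _.
by apply: height_eq0 => x; apply: ez.
Qed.

Lemma cobounded_le B B' J : B <= B' -> cobounded B J -> cobounded B' J.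
Proof.
move=> /subnK <- Jb i; rewrite exprD; apply: ideal_mull; exact: Jb.
Qed.

Lemma cobounded_X B I q : cobounded B I -> cobounded (B * q) (idealX I q).
Proof. by move=> Ib i; rewrite exprM; apply: idealX_mem. Qed.

(** Both counts equal the length of the quotient by [J], which does not refer to a box. *)
Lemma card_gaps_indep (R : realType) B B' J : cobounded B J -> cobounded B' J ->
  #|gaps B J| = #|gaps B' J|.
Proof.
move=> /(mlength_gaps R) e1 /(mlength_gaps R) e2; move: e1; rewrite e2 => -[].
by move/eqP; rewrite eqr_nat => /eqP.
Qed.

Lemma lexp_idealX I n m a b : lexp (idealX I n) a -> lexp (idealX I m) b ->
  lexp (idealX I (n + m)) (a + b).
Proof.
move=> /lexpP[f If fa] /lexpP[g Ig gb]; apply/lexpP.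
by exists (f * g)%R; [apply: idealX_mul | apply: lead_mul].
Qed.

Lemma lexp_idealXMn I p t a : lexp (idealX I p) a -> lexp (idealX I (p * t)) (a *+ t).
Proof.
move=> Ia; elim: t => [|t IHt].
  by rewrite muln0 mulm0n; apply: lexp_mon; apply: idgen_mem.
by rewrite mulnS mulmS; apply: lexp_idealX.
Qed.

(** Leading exponents add under products. This is the combination hypothesis of [sum_height_le] for
    the [p]-th and the [p * q]-th power. *)
Lemma exps_comb I p q t1 t2 t3 x1 y1 z1 x2 y2 z2 x3 y3 z3 : t1 + t2 + t3 = q ->
  exps (idealX I p) x1 y1 z1 -> exps (idealX I p) x2 y2 z2 ->
  exps (idealX I p) x3 y3 z3 ->
  exps (idealX I (p * q)) (t1 * x1 + t2 * x2 + t3 * x3)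
    (t1 * y1 + t2 * y2 + t3 * y3) (t1 * z1 + t2 * z2 + t3 * z3).
Proof.
move=> <- /(lexp_idealXMn t1) e1 /(lexp_idealXMn t2) e2 /(lexp_idealXMn t3) e3.
have := lexp_idealX (lexp_idealX e1 e2) e3; rewrite -!mulnDr.
suff -> : (mnm3 x1 y1 z1 *+ t1 + mnm3 x2 y2 z2 *+ t2 + mnm3 x3 y3 z3 *+ t3)%MM =
  mnm3 (t1 * x1 + t2 * x2 + t3 * x3) (t1 * y1 + t2 * y2 + t3 * y3)
   (t1 * z1 + t2 * z2 + t3 * z3) by [].
by apply: mnm3P; rewrite mnm3E !mnmDE !mulmnE !mnm3E; lia.
Qed.

Lemma orderge_exps N J x y z :
  {subset J <= orderge k N} -> exps J x y z -> N <= x + y + z.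
Proof.
move=> sJ /lexpP[f /sJ/ordergeP f0 [fa _]]; rewrite leqNgt; apply: contra fa => lt_N.
by rewrite f0 // mdeg_mnm3.
Qed.

Section HilbertSamuel.
Variables (I : ideal S) (B : nat).
Hypothesis Ib : cobounded B I.

(** The length of the quotient by the [n]-th power of [I]; the box of side [B * n] suffices by
    [cobounded_X]. *)
Definition hilbert n := #|gaps (B * n) (idealX I n)|.

Lemma hilbert_mono (R : realType) : {homo hilbert : m n / m <= n}.
Proof.
move=> m n le_mn; have Bm := cobounded_X m Ib.
have le_B : B * m <= B * n by rewrite leq_mul2l le_mn orbT.
rewrite /hilbert (card_gaps_indep R Bm (cobounded_le le_B Bm)).
exact/subset_leq_card/gaps_sub/idealX_anti.
Qed.

Lemma hilbert_hull p q :
  6 * hilbert (p * q) <= q ^ 3 * hull_weight (B * p) (exps (idealX I p)) +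
    (3 * q ^ 2 + 2 * q) * hilbert p.
Proof.
rewrite /hilbert !card_gaps mulnA; apply: sum_height_le.
- by move=> x x' y z lex; apply: exps_mono.
- by move=> y z; apply: exps_out (cobounded_X p Ib) _; rewrite leqnn.
- by move=> x x' y z lex; apply: exps_mono.
- move=> t1 t2 t3 x1 y1 z1 x2 y2 z2 x3 y3 z3; exact: exps_comb.
Qed.

Lemma hull_weight_le B' J : cobounded B' J ->
  hull_weight B' (exps J) <= 6 * #|gaps B' J|.
Proof.
move=> Jb; have [-> |B0] := posnP B'.
  by rewrite /hull_weight !big_ord0.
have eB1 x y : exps J x B' y by apply: exps_out Jb _; rewrite leqnn orbT.
have eB2 x y : exps J x y B' by apply: exps_out Jb _; rewrite leqnn !orbT.
have := hull_weightE eB1 eB2 B0; rewrite -card_gaps.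
(* An axis sum contains the height at the origin and so absorbs the corner term. *)
case: B' B0 {Jb eB1 eB2} => // B' _; rewrite big_ord_recl /=; lia.
Qed.

(** Six times the left side is at most [6 * q ^ 3 + 3 * q ^ 2 + 2 * q] times [hilbert p], and the
    lower terms are at most [5 * q ^ 2]. *)
Lemma hilbert_submul p q : hilbert (p * q) <= (q ^ 3 + q ^ 2) * hilbert p.
Proof.
have := hilbert_hull p q; have := hull_weight_le (cobounded_X p Ib).
rewrite -/(hilbert p) => leX.
have le_q : q <= q ^ 2 by case: q => // q; rewrite expnS expn1; nia.
have le1 := leq_mul (leqnn (q ^ 3)) leX.
have le2 := leq_mul le_q (leqnn (hilbert p)).
rewrite !mulnDl; nia.
Qed.

End HilbertSamuel.

End Gaps.

(** * The multiplicity *)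

Section Multiplicity.
Local Open Scope classical_set_scope.
Local Open Scope ring_scope.
Variables (R : realType) (k : fieldType).
Local Notation S := (mpseries 3 k).
Implicit Types (I J : ideal S) (B : nat).

Definition hs_ratio I B (n : nat) : R := (3`!)%:R * ((hilbert I B n)%:R / n%:R ^+ 3).

Lemma hs_ratio_cvg I B : cobounded B I -> cvgn (hs_ratio I B).
Proof.
move=> Ib; apply: is_cvgMr; apply: cvg_cube_ratio.
  exact: hilbert_mono.
exact: hilbert_submul.
Qed.

Lemma multiplicityE I B : cobounded B I ->
  multiplicity R 3 I = (limn (hs_ratio I B))%:E.
Proof.
move=> Ib; rewrite /multiplicity -EFin_lim; last exact: hs_ratio_cvg.
congr (limn _); apply/funext => n /=.
by rewrite (mlength_gaps R (cobounded_X n Ib)) -EFinM /hs_ratio mulrAC mulrA.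
Qed.

Lemma exps_idealX1 I : exps (idealX I 1) = exps I.
Proof.
apply/funext => x; apply/funext => y; apply/funext => z; apply/idP/idP.
  apply: lexp_sub => f /=; move: f; apply: idgen_sub => f [g Ig [h _ ->]].
  by rewrite mulrC; apply: ideal_mull.
apply: lexp_sub => f If; rewrite -[f]mulr1; apply: idealM_mem => //.
exact: idgen_mem.
Qed.

(** [hilbert_hull] at [p = 1]: after division by [n ^ 3] its error is at most [5 / n] times a
    constant. *)
Lemma lim_hs_ratio_le I B : cobounded B I ->
  limn (hs_ratio I B) <= (hull_weight B (exps I))%:R.
Proof.
move=> Ib; pose X := hull_weight B (exps I); pose H := hilbert I B 1.
have bnd : X%:R + 5 * n%:R^-1 * H%:R @[n --> \oo] --> (X%:R + 5 * 0 * H%:R : R).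
  apply: cvgD; first exact: cvg_cst.
  by apply: cvgM; [apply: cvgM; [exact: cvg_cst|exact: cvg_invn]|exact: cvg_cst].
rewrite -/X (_ : X%:R = X%:R + 5 * 0 * H%:R); last by rewrite mulr0 mul0r addr0.
apply: (ler_cvg_to (hs_ratio_cvg Ib) bnd).
near=> n; have n0 : (0 < n)%N by near: n; exact: nbhs_infty_gt.
have := hilbert_hull Ib 1 n; rewrite muln1 mul1n exps_idealX1 -/X -/H => le_n.
have n0' : 0 < n%:R :> R by rewrite ltr0n.
rewrite /hs_ratio mulrA ler_pdivrMr ?exprn_gt0 //.
have -> : (X%:R + 5 * n%:R^-1 * H%:R) * n%:R ^+ 3 =
    (n ^ 3 * X + 5 * n ^ 2 * H)%N%:R :> R.
  rewrite natrD (natrM _ (n ^ 3)%N) (natrM _ (5 * n ^ 2)%N) (natrM _ 5) !natrX.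
  by field; rewrite gt_eqF.
rewrite -natrM ler_nat; apply: leq_trans le_n _; rewrite leq_add2l leq_mul2r.
by apply/orP; right; rewrite !expnS expn0; nia.
Unshelve. all: by end_near.
Qed.

Lemma lim_hs_ratio_ge I B n : cobounded B I ->
  (forall q, (n * q) ^ 3 <= 6 * hilbert I B q)%N ->
  n%:R ^+ 3 <= limn (hs_ratio I B).
Proof.
move=> Ib le_h; apply: limr_ge; first exact: hs_ratio_cvg.
near=> q; have q0 : (0 < q)%N by near: q; exact: nbhs_infty_gt.
rewrite /hs_ratio mulrA ler_pdivlMr ?exprn_gt0 ?ltr0n //.
by rewrite -exprMn -!natrM -natrX ler_nat le_h.
Unshelve. all: by end_near.
Qed.

Lemma primary_to_cobounded I : primary_to (mps_max 3 k) I ->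
  exists2 B, (0 < B)%N & cobounded B I.
Proof.
move=> [_ radI].
have [n0 I0] := (radI _).2 (mps_max_X k o0).
have [n1 I1] := (radI _).2 (mps_max_X k o1).
have [n2 I2] := (radI _).2 (mps_max_X k o2).
(* The sum exceeds each of the three exponents or equals it; the successor makes the box
   nonempty. *)
exists (n0 + n1 + n2).+1 => //.
have pow x n N : (n <= N)%N -> x ^+ n \in I -> x ^+ N \in I.
  by move=> /subnK <- Ix; rewrite exprD; apply: ideal_mull.
by apply: ord3P; [apply: pow I0|apply: pow I1|apply: pow I2]; lia.
Qed.

(** * Axis terms and the quotients by the variables *)

Section Slices.
Variable I : ideal S.
Let x1 : S := mpsX k o1.
Let x2 : S := mpsX k o2.
Let I1 := idealD I (idgen [set x1]).
Let I2 := idealD I (idgen [set x2]).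
Let I12 := idealD I (idgen [set x1; x2]).

Lemma lexp_X J i (a : 'X_{1..3}) : mpsX k i \in J -> (0 < a i)%N -> lexp J a.
Proof.
move=> Ji ai; apply: (@lexp_le _ _ U_(i)%MM); last exact: lexp_mon.
by apply/mnm_lepP => j; rewrite mnm1E; case: eqP => // <-.
Qed.

Lemma exps_slice1 x y z : exps I1 x y.+1 z.
Proof.
apply: (lexp_X (i := o1)); last by rewrite mnm3E.
by apply: idealD_subr; apply: idgen_mem.
Qed.

Lemma exps_slice2 x y z : exps I2 x y z.+1.
Proof.
apply: (lexp_X (i := o2)); last by rewrite mnm3E.
by apply: idealD_subr; apply: idgen_mem.
Qed.

Lemma exps_slice12 x y z : exps I12 x y.+1 z /\ exps I12 x y z.+1.
Proof.
split; [apply: (lexp_X (i := o1))|apply: (lexp_X (i := o2))]; rewrite ?mnm3E //.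
  by apply: idealD_subr; apply: idgen_mem; left.
by apply: idealD_subr; apply: idgen_mem; right.
Qed.

(* On the x_0-axis the lexicographic predecessors stay on the axis, where
   multiples of x_1 and x_2 do not contribute. *)
Lemma exps_axis x : exps I12 x 0 0 -> exps I x 0 0.
Proof.
pose T (a : 'X_{1..3}) := (a o1 == 0%N) && (a o2 == 0%N).
have downT u v : T (u + v)%MM -> T v by rewrite /T !mnmDE; lia.
have sub : {subset I12 <= agree I (T := T) downT}.
  apply: idealD_min; first exact: agree_sub.
  apply: idgen_sub => f f12; apply/agreeP; exists 0; first exact: (@rpred0 S^o).
  move=> a /andP[/eqP a1 /eqP a2]; rewrite coefps0.
  by case: f12 => -> /=; case: eqP => // ea; move: a1 a2; rewrite ea !mnmE ?eqxx.
move=> /lexpP[f /sub /agreeP[g Ig fg] [fa f0]]; apply/lexpP; exists g => //.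
split; first by rewrite -fg // /T !mnm3E.
move=> b ltb; rewrite -fg ?f0 //; move: ltb; rewrite /lexlt /T !mnm3E; lia.
Qed.

Variable B : nat.
Hypotheses (B0 : (0 < B)%N) (Ib : cobounded B I).

Lemma card_slice1 : #|gaps B I1| = (\sum_(z < B) height B (exps I1) 0 z)%N.
Proof. by apply: card_gaps_y => // x y z; apply: exps_slice1. Qed.

Lemma card_slice2 : #|gaps B I2| = (\sum_(y < B) height B (exps I2) y 0)%N.
Proof. by apply: card_gaps_z => // x y z; apply: exps_slice2. Qed.

Lemma card_slice12 : #|gaps B I12| = height B (exps I12) 0 0.
Proof. by apply: card_gaps_yz => // x y z; have [] := exps_slice12 x y z. Qed.

(** Axis terms enter negatively, so enlarging [I] to [I1] or [I2] there goes the right way. The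
    corner enters positively and needs the reverse comparison, [exps_axis]. *)
Lemma hull_weight_slices :
  (hull_weight B (exps I) + 3 * #|gaps B I1| + 3 * #|gaps B I2| <=
     6 * #|gaps B I| + #|gaps B I12|)%N.
Proof.
have eB1 x y : exps I x B y by apply: exps_out Ib _; rewrite leqnn orbT.
have eB2 x y : exps I x y B by apply: exps_out Ib _; rewrite leqnn !orbT.
have := hull_weightE eB1 eB2 B0; rewrite -card_gaps.
have c1 := card_slice1; have c2 := card_slice2; have c12 := card_slice12.
have le1 : (\sum_(z < B) height B (exps I1) 0 z <= \sum_(z < B) height B (exps I) 0 z)%N.
  apply: leq_sum => z _; apply: height_sub => x; apply: lexp_sub; exact: idealD_subl.
have le2 : (\sum_(y < B) height B (exps I2) y 0 <= \sum_(y < B) height B (exps I) y 0)%N.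
  apply: leq_sum => z _; apply: height_sub => x; apply: lexp_sub; exact: idealD_subl.
have le12 : (height B (exps I) 0 0 <= height B (exps I12) 0 0)%N.
  by apply: height_sub => x; apply: exps_axis.
lia.
Qed.

End Slices.

(** * Equality for powers of the maximal ideal *)

Section MaxPower.
Variables (I : ideal S) (n : nat).
Hypothesis In : I =i idealX (mps_max 3 k) n.
Local Open Scope nat_scope.

Lemma max_power_cobounded : cobounded n I.
Proof. by move=> i; rewrite In; apply/idealX_mem/mps_max_X. Qed.

Lemma max_power_order : {subset I <= orderge k n}.
Proof.
move=> f; rewrite In -{2}[n]mul1n; apply: orderge_idealX; exact: mps_max_order.
Qed.

Lemma max_power_exps x y z : n <= x + y + z -> exps I x y z.
Proof.
move=> le_n; apply: lexp_mon; rewrite In.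
exact: idealX_anti le_n _ (mpsmon_mem k x y z).
Qed.

(** Elements of the [q]-th power of [I] have order at least [n * q], so all [tri_lo (n * q)]
    exponents of smaller degree are gaps. *)
Lemma max_power_hilbert q : (n * q) ^ 3 <= 6 * hilbert I n q.
Proof.
apply: (@leq_trans (6 * tri_lo (n * q))); first by rewrite tri_lo6; lia.
rewrite leq_mul2l /hilbert card_gaps /=; apply: leq_sum => y _; apply: leq_sum => z _.
apply: height_ge => [|x]; first exact: leq_subr.
move=> /(orderge_exps (orderge_idealX max_power_order (q := q))); lia.
Qed.

Lemma max_power_card : #|gaps n I| <= tri_lo n.
Proof.
rewrite card_gaps; apply: leq_sum => y _; apply: leq_sum => z _.
by apply: height_le => x le_x; apply: max_power_exps; lia.
Qed.

(** Modulo the multiples of the variable [i], elements of the sum still have no terms of degree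
    below [n]. *)
Lemma max_power_slice i (a : 'X_{1..3}) : lexp (idealD I (idgen [set mpsX k i])) a ->
  a i = 0 -> n <= mdeg a.
Proof.
pose T (b : 'X_{1..3}) := (b i == 0) && (mdeg b < n).
have downT u v : T (u + v)%MM -> T v by rewrite /T mnmDE mdegD; lia.
have sub : {subset idealD I (idgen [set mpsX k i]) <= vanish k (T := T) downT}.
  apply: idealD_min.
    by move=> f /max_power_order/ordergeP f0; apply/vanishP => b /andP[_ /f0].
  apply: idgen_sub => _ ->; apply/vanishP => b /andP[/eqP bi _] /=.
  by case: eqP => // eb; move: bi; rewrite eb mnm1E eqxx.
move=> /lexpP[f /sub/vanishP f0 [fa _]] ai; rewrite leqNgt; apply: contra fa => lt_n.
by rewrite f0 // /T ai eqxx.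
Qed.

(** The bounds [n * (n + 1) * (n + 2) / 6] and [n] above and [n * (n + 1) / 2] below, with weights
    6, 1 and twice -3, combine to exactly [n ^ 3]. *)
Lemma max_power_slices : 0 < n ->
  6 * #|gaps n I| + #|gaps n (idealD I (idgen [set mpsX k o1; mpsX k o2]))| <=
  n ^ 3 + 3 * #|gaps n (idealD I (idgen [set mpsX k o1]))|
        + 3 * #|gaps n (idealD I (idgen [set mpsX k o2]))|.
Proof.
move=> n0; pose I1 := idealD I (idgen [set mpsX k o1]).
pose I2 := idealD I (idgen [set mpsX k o2]).
pose I12 := idealD I (idgen [set mpsX k o1; mpsX k o2]).
have le1 : \sum_(z < n) (n - z) <= #|gaps n I1|.
  rewrite (card_slice1 I n0); apply: leq_sum => z _.
  apply: height_ge => [|x]; first exact: leq_subr.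
  by move=> /max_power_slice; rewrite mnm3E mdeg_mnm3 => /(_ erefl); lia.
have le2 : \sum_(y < n) (n - y) <= #|gaps n I2|.
  rewrite (card_slice2 I n0); apply: leq_sum => y _.
  apply: height_ge => [|x]; first exact: leq_subr.
  by move=> /max_power_slice; rewrite mnm3E mdeg_mnm3 => /(_ erefl); lia.
have le12 : #|gaps n I12| <= n.
  rewrite (card_slice12 I n0); apply: height_le => x le_x.
  apply: (lexp_sub (I := I)); first exact: idealD_subl.
  by apply: max_power_exps; lia.
rewrite -/I1 -/I2 -/I12.
have := max_power_card; have := tri_lo6 n; have := sum_subn_ord n.
lia.
Qed.

End MaxPower.

End Multiplicity.

Lemma mlength_gaps_combine (R : realType) (k : fieldType) B
    (J0 J1 J2 J12 : ideal (mpseries 3 k)) :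
  cobounded B J0 -> cobounded B J1 -> cobounded B J2 -> cobounded B J12 ->
  (6%:E * mlength R {ideal_quot J0} - 3%:E * mlength R {ideal_quot J1}
   - 3%:E * mlength R {ideal_quot J2} + mlength R {ideal_quot J12})%E =
  ((6 * #|gaps B J0| + #|gaps B J12|)%N%:R
   - (3 * #|gaps B J1| + 3 * #|gaps B J2|)%N%:R)%R%:E.
Proof.
do 4![move=> /(mlength_gaps R) ->].
move: #|gaps B J0| #|gaps B J1| #|gaps B J2| #|gaps B J12| => a b c d.
rewrite -!EFinM -!EFinB -EFinD; congr EFin.
by rewrite (natrD _ (6 * a)%N) (natrD _ (3 * b)%N) (natrM _ 6) !(natrM _ 3); ring.
Qed.

Theorem theorem7p1p2 (R : realType) (k : fieldType)
  (I : ideal (mpseries 3 k)) :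
  let S := mpseries 3 k in
  let m : ideal S := mps_max 3 k in
  let x1 : S := mpsX k (inord 1) in
  let x2 : S := mpsX k (inord 2) in
  let len (J : ideal S) : \bar R := mlength R {ideal_quot J} in
  let rhs : \bar R :=
    (6%:E * len I
     - 3%:E * len (idealD I (idgen [set x1]))
     - 3%:E * len (idealD I (idgen [set x2]))
     + len (idealD I (idgen [set x1; x2])))%E in
  primary_to m I ->
  (multiplicity R 3 I <= rhs)%E /\
  (forall n : nat, I =i idealX m n -> multiplicity R 3 I = rhs).
Proof.
move=> S m x1 x2 len rhs primI.
have rhsE B : cobounded B I -> rhs = ((6 * #|gaps B I|
    + #|gaps B (idealD I (idgen [set x1; x2]))|)%N%:R
    - (3 * #|gaps B (idealD I (idgen [set x1]))|
    + 3 * #|gaps B (idealD I (idgen [set x2]))|)%N%:R)%R%:E.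
  move=> Ib; have IbD (J : ideal S) : cobounded B (idealD I J).
    exact: cobounded_sub (@idealD_subl _ I J) Ib.
  exact: mlength_gaps_combine Ib (IbD _) (IbD _) (IbD _).
have le_rhs : (multiplicity R 3 I <= rhs)%E.
  have [B B0 Ib] := primary_to_cobounded primI.
  rewrite (rhsE B Ib) (multiplicityE R Ib) lee_fin.
  apply: (le_trans (lim_hs_ratio_le R Ib)).
  by rewrite lerBrDr -natrD ler_nat addnA; apply: hull_weight_slices.
split=> // n In; apply/eqP; rewrite eq_le le_rhs /=.
(* The power with exponent 0 is the unit ideal, which is not primary. *)
have n0 : (0 < n)%N.
  rewrite lt0n; apply/eqP => n0; case: primI => -[/negP nI1 _] _; apply: nI1.
  by rewrite In n0; apply: idgen_mem.
(* Here the box has side [n], for which the gap counts are explicit. *)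
have Ib := max_power_cobounded In.
rewrite (rhsE n Ib) (multiplicityE R Ib) lee_fin.
apply: le_trans (lim_hs_ratio_ge R Ib (max_power_hilbert In)).
by rewrite lerBlDr -natrX -natrD ler_nat addnA; apply: max_power_slices.
Qed.
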